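(* Let $\alpha$ be a nonzero real number and let $\varphi_\alpha(x):=1+4\alpha^2\frac{x^2}{(1+x^2)^2}$ for $x\ge 0$. Then $$\int_0^\infty\frac{1}{(1+x^2)^{\frac32}\sqrt{\varphi_\alpha(x)+\sqrt{\varphi_\alpha(x)^3}}}\,dx=\frac{\arctan\alpha}{\sqrt2\,\alpha}.$$ *)

(* Defs.v *)
From Stdlib Require Import Reals.
From Coquelicot Require Import Coquelicot.
Open Scope R_scope.

(* The function is used only at x >= 0; the same formula is kept on all of R. *)
Definition phi (alpha x : R) : R :=
  1 + 4 * alpha ^ 2 * (x ^ 2 / (1 + x ^ 2) ^ 2).

(* Main.v *)
Require Import Defs.
From Stdlib Require Import Reals Lra.
From Coquelicot Require Import Coquelicot.
Open Scope R_scope.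

(** Put [x = tan theta].  The integral becomes that of [cos theta / (y sqrt (1 + y))]
    over [[0, pi/2]], where [y = sqrt (1 + alpha^2 (sin (2 theta))^2)] is [sqrt (phi alpha x)].
    With [t = sin theta - cos theta] and [s = sin theta + cos theta],
<<
      1 - t^2 = sin (2 theta),   1 - s^2 = - sin (2 theta),
      cos theta dtheta = (dt + ds) / 2.
>>
    Hence the integrand is half the sum of the same form
    [du / (y sqrt (1 + y))], [y = sqrt (1 + alpha^2 (1 - u^2)^2)], taken at [u = t] and
    at [u = s].

    This form has an elementary primitive.  If [alpha (1 - u^2) = tan psi] and
    [w = tan (psi / 2)], it becomes a constant multiple of
    [dw / sqrt (1 - w^2 - 2 w / alpha)], whose primitive is an arcsine: up to a sign, it
    is the polar angle of the point [(1 + alpha w, alpha sqrt (1 - w^2 - 2 w / alpha))],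
    which moves on the circle of radius [sqrt (1 + alpha^2)] about the origin.  Multiplied
    by [1 + y], the point becomes [(angle_cos alpha u, angle_sin alpha u)] below, which is smooth in [u]
    and has norm [angle_radius alpha u].  The point never meets the negative half-axis, so
    half its polar angle is an arctangent that is smooth for all real [u]
    ([is_derive_angle]).

    The angle is odd in [u] and equals [atan alpha] at [u = 1].  As [x] goes from [0] to
    infinity, [t] goes from [-1] to [1] while [s] leaves [1] and comes back to [1]; so half
    the sum of the two angles goes from [0] to [atan alpha]. *)

(** * The polar angle of a moving point *)

(** The tangent of half the polar angle of [(C, S)] is [S / (N + C)], where [N] is the
    norm; this formula is smooth off the negative half-axis, and its derivative is
    [(C S' - S C') / N^2], as for any determination of the angle. *)
Lemma is_derive_polar_angle (C S N : R -> R) (u dC dS dN : R) :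
  is_derive C u dC -> is_derive S u dS -> is_derive N u dN ->
  (forall v, S v ^ 2 + C v ^ 2 = N v ^ 2) ->
  0 < N u -> 0 < N u + C u ->
  is_derive (fun v => 2 * atan (S v / (N v + C v))) u
    ((C u * dS - S u * dC) / N u ^ 2).
Proof.
  intros HC HS HN Hnorm HN0 HNC.
  assert (EC : Derive (fun v : R => C v) u = dC) by now apply is_derive_unique.
  assert (ES : Derive (fun v : R => S v) u = dS) by now apply is_derive_unique.
  assert (EN : Derive (fun v : R => N v) u = dN) by now apply is_derive_unique.
  (* Differentiating the norm equation eliminates [dN]. *)
  assert (HdN : N u * dN = C u * dC + S u * dS).
  { assert (H1 : is_derive (fun v => N v ^ 2) u (2 * (N u * dN))).
    { auto_derive; [now exists dN | rewrite EN; ring]. }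
    assert (H2 : is_derive (fun v => N v ^ 2) u (2 * (C u * dC + S u * dS))).
    { apply is_derive_ext with (fun v => S v ^ 2 + C v ^ 2); [exact Hnorm |].
      auto_derive.
      - split; [now exists dS | split; [now exists dC | exact I]].
      - rewrite ES, EC; ring. }
    apply is_derive_unique in H1, H2. lra. }
  auto_derive.
  - repeat split; try lra; eexists; eassumption.
  - rewrite ES, EC, EN.
    specialize (Hnorm u).
    assert (HdN' : dN = (C u * dC + S u * dS) / N u)
      by (rewrite <- HdN; field; lra).
    rewrite HdN'.
    set (c := C u) in *. set (s := S u) in *. set (r := N u) in *.
    assert (Hden : (r + c) ^ 2 + s ^ 2 = 2 * r * (r + c))
      by (replace (s ^ 2) with (r ^ 2 - c ^ 2) by lra; ring).
    transitivity (2 * (dS * (r + c) - s * ((c * dC + s * dS) / r + dC))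
                  / ((r + c) ^ 2 + s ^ 2)).
    { field. repeat split; try lra. rewrite Hden. nra. }
    rewrite Hden.
    replace (dS * (r + c) - s * ((c * dC + s * dS) / r + dC))
      with ((dS * (r ^ 2 - s ^ 2) + dS * r * c - s * c * dC - s * r * dC) / r)
      by (field; lra).
    replace (r ^ 2 - s ^ 2) with (c ^ 2) by lra.
    field. lra.
Qed.

(** * The primitive in the variable u *)

Definition root_phi (alpha u : R) : R := sqrt (1 + alpha ^ 2 * (1 - u ^ 2) ^ 2).

Definition angle_cos (alpha u : R) : R := 1 + root_phi alpha u + alpha ^ 2 * (1 - u ^ 2).

Definition angle_sin (alpha u : R) : R := alpha * u * sqrt (2 * (1 + root_phi alpha u)).

Definition angle_radius (alpha u : R) : R := (1 + root_phi alpha u) * sqrt (1 + alpha ^ 2).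

Definition angle (alpha u : R) : R :=
  2 * atan (angle_sin alpha u / (angle_radius alpha u + angle_cos alpha u)).

Lemma root_phi_pos (alpha u : R) : 0 < root_phi alpha u.
Proof. apply sqrt_lt_R0. pose proof (pow2_ge_0 (alpha * (1 - u ^ 2))). nra. Qed.

Lemma root_phi_sqr (alpha u : R) :
  root_phi alpha u ^ 2 = 1 + alpha ^ 2 * (1 - u ^ 2) ^ 2.
Proof. apply pow2_sqrt. pose proof (pow2_ge_0 (alpha * (1 - u ^ 2))). nra. Qed.

Lemma sqrt_1_sqr_pos (a : R) : 0 < sqrt (1 + a ^ 2).
Proof. apply sqrt_lt_R0. pose proof (pow2_ge_0 a). lra. Qed.

Lemma sqrt_1_sqr_sqr (a : R) : sqrt (1 + a ^ 2) ^ 2 = 1 + a ^ 2.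
Proof. apply pow2_sqrt. pose proof (pow2_ge_0 a). lra. Qed.

Lemma angle_radius_pos (alpha u : R) : 0 < angle_radius alpha u.
Proof.
  apply Rmult_lt_0_compat; [pose proof (root_phi_pos alpha u); lra | apply sqrt_1_sqr_pos].
Qed.

Lemma angle_norm (alpha u : R) :
  angle_sin alpha u ^ 2 + angle_cos alpha u ^ 2 = angle_radius alpha u ^ 2.
Proof.
  unfold angle_sin, angle_cos, angle_radius.
  pose proof (root_phi_pos alpha u) as Hy. pose proof (root_phi_sqr alpha u) as Hy2.
  rewrite !Rpow_mult_distr, sqrt_1_sqr_sqr, pow2_sqrt by lra.
  set (y := root_phi alpha u) in *. clearbody y.
  nra.
Qed.

(** The point avoids the negative half-axis because [y >= |alpha (1 - u^2)|] and
    [sqrt (1 + alpha^2) >= |alpha|], so that their product outweighs the only term of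
    [angle_cos] that can be negative. *)
Lemma angle_off_half_axis (alpha u : R) :
  0 < angle_radius alpha u + angle_cos alpha u.
Proof.
  unfold angle_radius, angle_cos.
  pose proof (root_phi_pos alpha u) as Hy. pose proof (root_phi_sqr alpha u) as Hy2.
  pose proof (sqrt_1_sqr_pos alpha) as Hq. pose proof (sqrt_1_sqr_sqr alpha) as Hq2.
  set (y := root_phi alpha u) in *. set (q := sqrt (1 + alpha ^ 2)) in *.
  set (v := 1 - u ^ 2) in *. clearbody y q v.
  assert (H : - (alpha ^ 2 * v) <= y * q).
  { apply Rle_trans with (Rabs (alpha ^ 2 * v)).
    - rewrite <- Rabs_Ropp. apply Rle_abs.
    - rewrite <- (Rabs_pos_eq (y * q)) by nra.
      apply Rsqr_le_abs_0. unfold Rsqr.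
      replace (y * q * (y * q)) with (y ^ 2 * q ^ 2) by ring.
      rewrite Hy2, Hq2. pose proof (pow2_ge_0 alpha). pose proof (pow2_ge_0 (alpha * v)).
      nra. }
  nra.
Qed.

Lemma is_derive_root_phi (alpha u : R) :
  is_derive (root_phi alpha) u (- 2 * alpha ^ 2 * (1 - u ^ 2) * u / root_phi alpha u).
Proof.
  pose proof (root_phi_pos alpha u) as Hy. unfold root_phi in *.
  auto_derive.
  - apply sqrt_lt_0_alt. now rewrite sqrt_0.
  - replace (1 + alpha * (alpha * 1) * ((1 + - (u * (u * 1))) * ((1 + - (u * (u * 1))) * 1)))
      with (1 + alpha ^ 2 * (1 - u ^ 2) ^ 2) by ring.
    field. lra.
Qed.

(** The numerator [C S' - S C'] of the polar angle formula is divisible by the squared norm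
    [(1 + y)^2 (1 + alpha^2)], so that only [y sqrt (1 + y)] survives in the denominator. *)
Lemma is_derive_angle (alpha u : R) :
  is_derive (angle alpha) u
    (sqrt 2 * alpha / (root_phi alpha u * sqrt (1 + root_phi alpha u))).
Proof.
  pose proof (root_phi_pos alpha u) as Hy. pose proof (root_phi_sqr alpha u) as Hy2.
  pose proof (is_derive_root_phi alpha u) as Hdy.
  assert (Hr : 0 < sqrt (2 * (1 + root_phi alpha u))) by (apply sqrt_lt_R0; lra).
  set (dy := - 2 * alpha ^ 2 * (1 - u ^ 2) * u / root_phi alpha u) in *.
  set (r := sqrt (2 * (1 + root_phi alpha u))) in *.
  assert (Edy : Derive (fun v : R => root_phi alpha v) u = dy)
    by now apply is_derive_unique.
  assert (HC : is_derive (angle_cos alpha) u (dy - 2 * alpha ^ 2 * u)).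
  { unfold angle_cos. auto_derive; [now exists dy |].
    rewrite Edy. ring. }
  assert (HS : is_derive (angle_sin alpha) u (alpha * (r + u * dy / r))).
  { unfold angle_sin. auto_derive; [repeat split; [now exists dy | lra] |].
    rewrite Edy. fold r. field. lra. }
  assert (HR : is_derive (angle_radius alpha) u (dy * sqrt (1 + alpha ^ 2))).
  { unfold angle_radius. auto_derive; [now exists dy |].
    rewrite Edy.
    replace (1 + alpha * (alpha * 1)) with (1 + alpha ^ 2) by ring. ring. }
  replace (sqrt 2 * alpha / (root_phi alpha u * sqrt (1 + root_phi alpha u)))
    with ((angle_cos alpha u * (alpha * (r + u * dy / r))
           - angle_sin alpha u * (dy - 2 * alpha ^ 2 * u)) / angle_radius alpha u ^ 2).
  { apply is_derive_polar_angle with (1 := HC) (2 := HS) (3 := HR).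
    - intros v. apply angle_norm.
    - apply angle_radius_pos.
    - apply angle_off_half_axis. }
  unfold angle_cos, angle_sin, angle_radius.
  rewrite Rpow_mult_distr, sqrt_1_sqr_sqr.
  fold r.
  assert (Hr2 : r ^ 2 = 2 * (1 + root_phi alpha u)) by (apply pow2_sqrt; lra).
  assert (Hn : sqrt (1 + root_phi alpha u) = sqrt 2 * r / 2).
  { unfold r. rewrite sqrt_mult by lra.
    rewrite <- (sqrt_sqrt 2) at 3 by lra.
    field. apply Rgt_not_eq, sqrt_lt_R0. lra. }
  rewrite Hn.
  assert (H2 : 0 < sqrt 2) by (apply sqrt_lt_R0; lra).
  unfold dy. clearbody r. clear dy Hdy Edy HC HS HR Hn.
  set (y := root_phi alpha u) in *. clearbody y.
  assert (Ha : 0 <= alpha ^ 2) by apply pow2_ge_0.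
  (* Clearing denominators leaves a polynomial identity modulo the equations
     for [r^2] and [y^2]. *)
  assert (Key : (1 + y + alpha ^ 2 * (1 - u ^ 2))
                  * (r ^ 2 * y - 2 * alpha ^ 2 * (1 - u ^ 2) * u ^ 2)
                + u ^ 2 * r ^ 2 * (2 * alpha ^ 2 * (1 - u ^ 2) + 2 * alpha ^ 2 * y)
                = 2 * (1 + y) ^ 2 * (1 + alpha ^ 2)).
  { rewrite Hr2.
    transitivity (2 * (1 + y) ^ 2 * (1 + alpha ^ 2)
      + 2 * (1 + y + alpha ^ 2 * u ^ 2) * (y ^ 2 - (1 + alpha ^ 2 * (1 - u ^ 2) ^ 2))).
    - ring.
    - rewrite Hy2. ring. }
  transitivity (alpha / (r * y)
    * ((1 + y + alpha ^ 2 * (1 - u ^ 2))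
                  * (r ^ 2 * y - 2 * alpha ^ 2 * (1 - u ^ 2) * u ^ 2)
                + u ^ 2 * r ^ 2 * (2 * alpha ^ 2 * (1 - u ^ 2) + 2 * alpha ^ 2 * y))
     / ((1 + y) ^ 2 * (1 + alpha ^ 2))).
  - field. lra.
  - rewrite Key. field. lra.
Qed.

Lemma angle_opp (alpha u : R) : angle alpha (- u) = - angle alpha u.
Proof.
  unfold angle, angle_sin, angle_cos, angle_radius, root_phi.
  replace ((- u) ^ 2) with (u ^ 2) by ring.
  rewrite (Ropp_mult_distr_r 2), <- atan_opp. do 2 f_equal. unfold Rdiv. ring.
Qed.

(** At [u = 1] this is the half-angle identity [tan (b / 2) = tan b / (1 + sqrt (1 + (tan b)^2))]
    for [b = atan alpha]. *)
Lemma angle_1 (alpha : R) : angle alpha 1 = atan alpha.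
Proof.
  pose proof (sqrt_1_sqr_pos alpha) as Hq. pose proof (sqrt_1_sqr_sqr alpha) as Hq2.
  assert (Hz : angle alpha 1 = 2 * atan (alpha / (1 + sqrt (1 + alpha ^ 2)))).
  { unfold angle, angle_sin, angle_cos, angle_radius, root_phi.
    replace (1 + alpha ^ 2 * (1 - 1 ^ 2) ^ 2) with 1 by ring. rewrite sqrt_1.
    replace (2 * (1 + 1)) with (2 * 2) by ring. rewrite sqrt_square by lra.
    do 2 f_equal. field. lra. }
  rewrite Hz. set (q := sqrt (1 + alpha ^ 2)) in *. clearbody q.
  set (z := alpha / (1 + q)).
  assert (Hz2 : 1 - z * z = 2 / (1 + q)).
  { unfold z. transitivity (((1 + q) ^ 2 - alpha ^ 2) / (1 + q) ^ 2); [field; lra |].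
    replace (alpha ^ 2) with (q ^ 2 - 1) by lra. field. lra. }
  assert (Hpos : 0 < 1 - z * z).
  { rewrite Hz2. apply Rdiv_lt_0_compat; lra. }
  assert (Hb : - (PI / 4) < atan z < PI / 4).
  { rewrite <- atan_1, <- atan_opp. split; apply atan_increasing; nra. }
  rewrite <- (atan_tan (2 * atan z)) by lra. f_equal.
  rewrite tan_2a.
  - rewrite !tan_atan, Hz2. unfold z. field. lra.
  - apply Rgt_not_eq, cos_gt_0; lra.
  - apply Rgt_not_eq, cos_gt_0; lra.
  - rewrite !tan_atan. lra.
Qed.

(** * Return to the variable x *)

(** With [x = tan theta], [shift (-1) x] is [sin theta - cos theta] and [shift 1 x] is
    [sin theta + cos theta]. *)
Definition shift (e x : R) : R := (x + e) / sqrt (1 + x ^ 2).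

Lemma is_derive_shift (e x : R) :
  is_derive (shift e) x ((1 - e * x) / ((1 + x ^ 2) * sqrt (1 + x ^ 2))).
Proof.
  pose proof (sqrt_1_sqr_pos x) as Hs. pose proof (sqrt_1_sqr_sqr x) as Hs2.
  pose proof (pow2_ge_0 x).
  unfold shift. auto_derive.
  - replace (1 + x * (x * 1)) with (1 + x ^ 2) by ring. repeat split; lra.
  - replace (1 + x * (x * 1)) with (1 + x ^ 2) by ring.
    set (s := sqrt (1 + x ^ 2)) in *. clearbody s. rewrite <- Hs2.
    transitivity ((s ^ 2 - (x + e) * x) / s ^ 3); [field; lra |].
    replace (s ^ 2 - (x + e) * x) with (1 - e * x) by (rewrite Hs2; ring).
    field. lra.
Qed.

Lemma root_phi_shift (alpha e x : R) :
  e ^ 2 = 1 -> root_phi alpha (shift e x) = sqrt (phi alpha x).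
Proof.
  intros He. unfold root_phi, phi, shift. f_equal.
  pose proof (pow2_ge_0 x).
  unfold Rdiv at 1. rewrite Rpow_mult_distr, pow_inv, sqrt_1_sqr_sqr.
  fold ((x + e) ^ 2 / (1 + x ^ 2)).
  replace (1 - (x + e) ^ 2 / (1 + x ^ 2)) with (- (2 * e * x) / (1 + x ^ 2)).
  - replace ((- (2 * e * x) / (1 + x ^ 2)) ^ 2)
      with (4 * e ^ 2 * x ^ 2 / (1 + x ^ 2) ^ 2) by (field; lra).
    rewrite He. field. lra.
  - replace ((x + e) ^ 2) with (x ^ 2 + 2 * e * x + e ^ 2) by ring.
    rewrite He. field. lra.
Qed.

Lemma phi_ge_1 (alpha x : R) : 1 <= phi alpha x.
Proof.
  unfold phi. pose proof (pow2_ge_0 (2 * alpha * (x / (1 + x ^ 2)))) as H.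
  pose proof (pow2_ge_0 x).
  replace (4 * alpha ^ 2 * (x ^ 2 / (1 + x ^ 2) ^ 2))
    with ((2 * alpha * (x / (1 + x ^ 2))) ^ 2) by (field; lra).
  lra.
Qed.

Definition integrand (alpha x : R) : R :=
  1 / ((1 + x ^ 2) * sqrt (1 + x ^ 2)
       * (sqrt (phi alpha x) * sqrt (1 + sqrt (phi alpha x)))).

Lemma integrand_eq (alpha x : R) :
  1 / (Rpower (1 + x ^ 2) (3 / 2) * sqrt (phi alpha x + sqrt (phi alpha x ^ 3)))
  = integrand alpha x.
Proof.
  pose proof (phi_ge_1 alpha x) as Hphi. pose proof (pow2_ge_0 x).
  unfold integrand. f_equal. f_equal.
  - replace (3 / 2) with (1 + / 2) by lra.
    rewrite Rpower_plus, Rpower_1, Rpower_sqrt by lra. reflexivity.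
  - replace (phi alpha x ^ 3) with (phi alpha x ^ 2 * phi alpha x) by ring.
    rewrite sqrt_mult, sqrt_pow2 by nra.
    rewrite <- sqrt_mult by (try pose proof (sqrt_pos (phi alpha x)); lra).
    f_equal. ring.
Qed.

Lemma continuous_integrand (alpha x : R) : continuous (integrand alpha) x.
Proof.
  pose proof (phi_ge_1 alpha x) as Hphi. pose proof (pow2_ge_0 x).
  pose proof (sqrt_1_sqr_pos x) as Hs.
  assert (Hy : 0 < sqrt (phi alpha x)) by (apply sqrt_lt_R0; lra).
  assert (Hn : 0 < sqrt (1 + sqrt (phi alpha x))) by (apply sqrt_lt_R0; lra).
  assert (Hd : ex_derive (phi alpha) x).
  { unfold phi. auto_derive.
    replace (1 + x * (x * 1)) with (1 + x ^ 2) by ring. apply Rgt_not_eq. nra. }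
  apply (ex_derive_continuous (integrand alpha) x). unfold integrand. auto_derive.
  replace (1 + x * (x * 1)) with (1 + x ^ 2) by ring.
  repeat split; try assumption; try lra.
  apply Rgt_not_eq. repeat apply Rmult_lt_0_compat; lra.
Qed.

Definition primitive (alpha x : R) : R :=
  (angle alpha (shift (-1) x) + angle alpha (shift 1 x)) / (2 * sqrt 2 * alpha).

Lemma is_derive_primitive (alpha x : R) :
  alpha <> 0 -> is_derive (primitive alpha) x (integrand alpha x).
Proof.
  intros Halpha.
  assert (Hangle : forall e, e ^ 2 = 1 ->
    is_derive (fun x => angle alpha (shift e x)) x
      ((1 - e * x) * (sqrt 2 * alpha) * integrand alpha x)).
  { intros e He.
    pose proof (is_derive_comp _ _ _ _ _ (is_derive_angle alpha (shift e x))
                  (is_derive_shift e x)) as H.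
    rewrite root_phi_shift in H by exact He.
    eapply (eq_rect _ (is_derive _ x) H).
    unfold scal; simpl; unfold mult; simpl. unfold integrand, Rdiv.
    rewrite !Rinv_mult. simpl. ring. }
  assert (H2 : 0 < sqrt 2) by (apply sqrt_lt_R0; lra).
  pose proof (Hangle (-1) ltac:(ring)) as Ht. pose proof (Hangle 1 ltac:(ring)) as Hs.
  pose proof (is_derive_scal_l _ _ _ (/ (2 * sqrt 2 * alpha) : R_NormedModule)
                (is_derive_plus _ _ _ _ _ Ht Hs)) as H.
  eapply (eq_rect _ (is_derive _ x) H).
  unfold scal, plus; simpl; unfold mult; simpl. field. lra.
Qed.

Lemma primitive_0 (alpha : R) : primitive alpha 0 = 0.
Proof.
  unfold primitive, shift.
  replace (1 + 0 ^ 2) with 1 by ring. rewrite sqrt_1.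
  replace ((0 + -1) / 1) with (- (1)) by field.
  replace ((0 + 1) / 1) with 1 by field.
  rewrite angle_opp. unfold Rdiv. ring.
Qed.

Lemma is_lim_shift (e : R) : is_lim (shift e) p_infty 1.
Proof.
  (* In the variable [z = 1/x] the function extends continuously to [z = 0]. *)
  set (h := fun z => (1 + e * z) / sqrt (1 + z ^ 2)).
  assert (Hh : continuous h 0).
  { apply (ex_derive_continuous h 0). unfold h. auto_derive.
    replace (1 + 0 * (0 * 1)) with 1 by ring. rewrite sqrt_1. repeat split; lra. }
  replace 1 with (h 0)
    by (unfold h; replace (1 + 0 ^ 2) with 1 by ring; rewrite sqrt_1; field).
  apply is_lim_ext_loc with (fun x => h (/ x)).
  - exists 0. intros x Hx. unfold h, shift.
    pose proof (sqrt_1_sqr_pos x) as Hs.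
    replace (1 + (/ x) ^ 2) with ((1 + x ^ 2) / x ^ 2) by (field; lra).
    rewrite sqrt_div_alt, sqrt_pow2 by nra. field. lra.
  - apply is_lim_comp_continuous; [| exact Hh].
    apply (is_lim_inv (fun x => x) p_infty p_infty); [apply is_lim_id | discriminate].
Qed.

Lemma is_lim_primitive (alpha : R) :
  alpha <> 0 -> is_lim (primitive alpha) p_infty (atan alpha / (sqrt 2 * alpha)).
Proof.
  intros Halpha.
  assert (H : forall e, is_lim (fun x => angle alpha (shift e x)) p_infty (atan alpha)).
  { intros e. rewrite <- angle_1.
    apply is_lim_comp_continuous; [apply is_lim_shift |].
    apply (ex_derive_continuous (angle alpha) 1). eexists. apply is_derive_angle. }
  assert (H2 : 0 < sqrt 2) by (apply sqrt_lt_R0; lra).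
  replace (atan alpha / (sqrt 2 * alpha))
    with ((atan alpha + atan alpha) * / (2 * sqrt 2 * alpha)) by (field; lra).
  unfold primitive, Rdiv.
  apply (is_lim_scal_r _ (/ (2 * sqrt 2 * alpha)) p_infty (atan alpha + atan alpha)).
  now apply is_lim_plus'.
Qed.

Theorem proposition5 (alpha : R) (halpha : alpha <> 0) :
  is_RInt_gen
    (fun x : R =>
       1 / (Rpower (1 + x ^ 2) (3 / 2)
            * sqrt (phi alpha x + sqrt (phi alpha x ^ 3))))
    (at_point 0) (Rbar_locally p_infty)
    (atan alpha / (sqrt 2 * alpha)).
Proof.
  assert (Hd : forall x, Derive (primitive alpha) x = integrand alpha x)
    by (intros x; now apply is_derive_unique, is_derive_primitive).
  apply is_RInt_gen_ext with (Derive (primitive alpha)).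
  { apply filter_forall. intros ab x _. now rewrite Hd, integrand_eq. }
  rewrite <- (Rminus_0_r (atan alpha / (sqrt 2 * alpha))).
  apply is_RInt_gen_Derive.
  - apply filter_forall. intros ab x _. eexists. now apply is_derive_primitive.
  - apply filter_forall. intros ab x _.
    apply continuous_ext with (integrand alpha); [now intros y | apply continuous_integrand].
  - intros P HP. unfold filtermap, at_point. rewrite primitive_0. now apply locally_singleton.
  - now apply is_lim_primitive.
Qed.
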